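(* Let $a,b$ be relatively prime positive odd integers such that one of the four fractions $\frac ba,\frac ab,\frac{3a}b,\frac b{3a}$ lies in $\{\frac53,7,15\}$. Then for every positive integer $n$, $$2t(a,3a,b;n)=3r\big(\langle a,3a,b\rangle,\,8n+4a+b\big)-r\big(\langle a,3a,b\rangle,\,4(8n+4a+b)\big).$$
   Context: For positive integers $a,b,c$ and an integer $n$, $t(a,b,c;n)$ denotes the number of $(x,y,z)\in\mathbb Z^3$ with $a\frac{x(x-1)}2+b\frac{y(y-1)}2+c\frac{z(z-1)}2=n$. $\langle a,b,c\rangle$ denotes the quadratic form $ax^2+by^2+cz^2$, and $r(h,m)$ denotes the number of integer vectors $v$ with $h(v)=m$. *)

(* Defs.v *)
From HB Require Import structures.
From mathcomp Require Import all_boot all_order all_algebra.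
From mathcomp Require Import finmap.
From mathcomp Require Import boolp classical_sets functions cardinality.

Set Implicit Arguments.
Unset Strict Implicit.
Unset Printing Implicit Defensive.

Import Order.TTheory GRing.Theory Num.Theory.
Local Open Scope ring_scope.
Local Open Scope classical_set_scope.

(* [fset_set] returns the empty set on an infinite argument, so [npoints A]
   is the cardinality of A only when A is finite; this is the case for all
   the solution sets below when the coefficients are positive. *)
Definition npoints (A : set (int * int * int)) : nat := #|` fset_set A |%fset.

(* x * (x - 1) is even, so the Euclidean quotient is exact. *)
Definition tri (x : int) : int := ((x * (x - 1)) %/ 2)%Z.

Definition t (a b c n : int) : nat :=
  npoints [set v | a * tri v.1.1 + b * tri v.1.2 + c * tri v.2 = n].

Definition diag_form (a b c : int) (v : int * int * int) : int :=
  a * v.1.1 ^+ 2 + b * v.1.2 ^+ 2 + c * v.2 ^+ 2.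

Definition r (h : int * int * int -> int) (m : int) : nat :=
  npoints [set v | h v = m].

(* Main.v *)
(* Completing squares, t(a,3a,b;n) counts the solutions of F = m in odd
   integers, where F = <a,3a,b> and m = 8n + 4a + b.  Multiplication by a cube
   root of unity in Z[w] acts on x^2 + 3y^2, so that of the solutions with z odd
   exactly one third have x, y even; hence r(F,m) = E + 3t/2, with E the number
   of solutions with z even.  The same action gives
   r(F,4m) = r(F,m) + 2E + #{F = 4m, z odd}, and everything reduces to
   #{F = 4m, z odd} = t.  The ratio condition says that <a,b> or <3a,b> is
   g<p,q> with pq = 7 or 15 and p + q divisible by 8.  As c^2 + pq = 16 for c = 3
   or c = 1, the map (x,z) |-> ((cx - qz)/2, (px + cz)/2) multiplies
   px^2 + qz^2 by 4, and up to the sign of z it is a bijection between the pairs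
   of odd integers on both sides, while the third variable is doubled. *)
Require Import Defs.
From HB Require Import structures.
From mathcomp Require Import all_boot all_order all_algebra.
From mathcomp Require Import finmap zify ring.
From mathcomp Require Import boolp classical_sets functions cardinality.

Import Order.TTheory GRing.Theory Num.Theory.

Local Open Scope ring_scope.

(** * Counting by bijections, splittings and involutions *)

(** The inverse laws are required only on [A] and [B], so [f] and [g] may be built from Euclidean
    quotients that are exact there. *)
Lemma npoints_bij (A B : set (int * int * int)) f g :
  finite_set A ->
  (forall v, A v -> B (f v) /\ g (f v) = v) ->
  (forall v, B v -> A (g v) /\ f (g v) = v) ->
  npoints A = npoints B.
Proof.
move=> finA fAB gBA; rewrite /npoints.
have -> : B = (f @` A)%classic.
  apply/seteqP; split=> v /=.
    by move=> /gBA[Agv fgv]; exists (g v).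
  by move=> [u /fAB[Bfu _] <-].
rewrite fset_set_image// card_in_imfset// => u v.
rewrite !in_fset_set// !inE => /fAB[_ gfu] /fAB[_ gfv] fuv.
by rewrite -gfu fuv gfv.
Qed.

Lemma npoints_split (A : set (int * int * int)) (P : pred (int * int * int)) :
  finite_set A ->
  npoints A = (npoints [set v | A v /\ P v] +
               npoints [set v | A v /\ ~~ P v])%N.
Proof.
move=> finA; rewrite /npoints.
have finAP : finite_set [set v | A v /\ P v].
  by apply: sub_finite_set finA => v [].
have finANP : finite_set [set v | A v /\ ~~ P v].
  by apply: sub_finite_set finA => v [].
rewrite -cardfsUI -fset_setU// -fset_setI//.
have -> : ([set v | A v /\ P v] `&` [set v | A v /\ ~~ P v] = set0)%classic.
  by apply/seteqP; split=> v //= [[_ ->] [_]].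
rewrite fset_set0 cardfs0 addn0; congr (#|` fset_set _|).
apply/seteqP; split=> v /=; last by case=> -[].
by move=> Av; case: (boolP (P v)); [left|right].
Qed.

(** [f] exchanges the points of [A] where [P] holds with those where it fails. In use, [f] changes
    the sign of one coordinate. *)
Lemma npoints_double (A : set (int * int * int)) (P : pred (int * int * int)) f :
  finite_set A -> involutive f ->
  (forall v, A v -> A (f v) /\ P (f v) = ~~ P v) ->
  npoints A = (npoints [set v | A v /\ P v]).*2.
Proof.
move=> finA fK fA; rewrite (npoints_split _ P)// -addnn; congr addn.
apply: (npoints_bij _ _ f f).
- by apply: sub_finite_set finA => v [].
- by move=> v [/fA[Afv Pfv] nPv]; split; rewrite /= ?fK ?Pfv.
- by move=> v [/fA[Afv Pfv] Pv]; split; rewrite /= ?fK ?Pfv ?Pv.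
Qed.

(** * Finiteness of the solution sets of a positive diagonal form *)

Lemma finite_int_segment (N : int) : finite_set [set x : int | - N <= x <= N].
Proof.
pose f (k : nat) : int := k%:Z - N.
apply: (@sub_finite_set _ _ (f @` `I_(`|(2 * N + 1)%R|%N))%classic).
  by move=> x /= xN; exists `|(x + N)%R|%N; rewrite /f /=; lia.
exact: finite_image (finite_II _).
Qed.

Lemma sqr_bound (c x : int) : 0 < c -> - (c * x ^+ 2) <= x <= c * x ^+ 2.
Proof.
move=> c0; have : 0 <= (c - 1) * x ^+ 2 by rewrite mulr_ge0 ?sqr_ge0//; lia.
nia.
Qed.

Lemma finite_diag_form (a b c M : int) : 0 < a -> 0 < b -> 0 < c ->
  finite_set [set v | diag_form a b c v = M].
Proof.
move=> a0 b0 c0.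
pose I := [set x : int | - M <= x <= M]%classic.
have finI : finite_set I by exact: finite_int_segment.
apply: (@sub_finite_set _ _ (I `*` I `*` I)%classic); last first.
  by do !apply: finite_setX.
move=> [[x y] z]; rewrite /diag_form/= => defM.
have := sqr_ge0 x; have := sqr_ge0 y; have := sqr_ge0 z => z2 y2 x2.
have ax := mulr_ge0 (ltW a0) x2; have bY := mulr_ge0 (ltW b0) y2.
have cz := mulr_ge0 (ltW c0) z2.
have := sqr_bound a x a0; have := sqr_bound b y b0; have := sqr_bound c z c0.
by move=> hz hy hx; rewrite /I /=; split; [split|] => /=; lia.
Qed.

(** * Squares and odd factors modulo powers of 2 *)

Lemma sqr_odd (x : int) : ~~ (2 %| x)%Z -> exists k, x ^+ 2 = 8 * k + 1.
Proof.
move=> ox; pose y := (x %/ 4)%Z.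
have [->|->] : x = 4 * y + 1 \/ x = 4 * y + 3 by rewrite /y; lia.
- by exists (2 * y ^+ 2 + y); ring.
- by exists (2 * y ^+ 2 + 3 * y + 1); ring.
Qed.

(** Here k = (x/2)^2 has the parity of x/2. *)
Lemma sqr_even (x : int) : (2 %| x)%Z ->
  exists2 k, x ^+ 2 = 4 * k & (2 %| k)%Z = (4 %| x)%Z.
Proof.
move=> ex; pose y := (x %/ 4)%Z.
have [->|->] : x = 4 * y \/ x = 4 * y + 2 by rewrite /y; lia.
- by exists (4 * y ^+ 2); [ring|lia].
- by exists (4 * y ^+ 2 + 4 * y + 1); [ring|lia].
Qed.

Lemma odd_mulz (x y : int) :
  ~~ (2 %| x)%Z -> ~~ (2 %| y)%Z -> ~~ (2 %| x * y)%Z.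
Proof.
move=> ox oy; have [u ->] : exists u, x = 2 * u + 1 by exists (x %/ 2)%Z; lia.
have [v ->] : exists v, y = 2 * v + 1 by exists (y %/ 2)%Z; lia.
by lia.
Qed.

Lemma dvdz_odd_mull (k : nat) (x y : int) :
  ~~ (2 %| x)%Z -> (2%:Z ^+ k %| x * y)%Z -> (2%:Z ^+ k %| y)%Z.
Proof.
move=> ox; rewrite Gauss_dvdzr// coprimezE abszX coprimeXl//.
by rewrite prime_coprime//; lia.
Qed.

(** * The norm-4 twist of the binary form g<p,q> *)

Section BinaryTwist.

Variables g p q c s M : int.
Hypotheses (g_odd : ~~ (2 %| g)%Z) (p_odd : ~~ (2 %| p)%Z).
Hypotheses (c_odd : ~~ (2 %| c)%Z) (s_odd : ~~ (2 %| s)%Z).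
Hypotheses (gp_gt0 : 0 < g * p) (s_gt0 : 0 < s) (gq_gt0 : 0 < g * q).
Hypotheses (norm16 : c ^+ 2 + p * q = 16) (pq8 : (8 %| p + q)%Z).
Hypothesis Ms8 : (8 %| M - s)%Z.

(** With d = sqrt(-pq), this is multiplication of px + dz by (c + d)/2, whose norm is (c^2 + pq)/4 =
    4. *)
Lemma twist_norm (x z u v : int) :
  2 * u = c * x - q * z -> 2 * v = p * x + c * z ->
  p * u ^+ 2 + q * v ^+ 2 = 4 * (p * x ^+ 2 + q * z ^+ 2).
Proof.
move=> uE vE.
have : p * (2 * u) ^+ 2 + q * (2 * v) ^+ 2 = 16 * (p * x ^+ 2 + q * z ^+ 2).
  by rewrite uE vE -norm16; ring.
by clear; lia.
Qed.

Lemma sqr_sum_mod8 (u v : int) : ~~ (2 %| u)%Z -> ~~ (2 %| v)%Z ->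
  (8 %| p * u ^+ 2 + q * v ^+ 2)%Z.
Proof.
move=> /sqr_odd[k ->] /sqr_odd[l ->].
have [h hE] : exists h, q = 8 * h - p.
  by exists ((p + q) %/ 8)%Z; clear -pq8; lia.
by rewrite hE; clear; lia.
Qed.

(** The outer terms sum to a multiple of 8 while 4M = 4s mod 32 with s odd, so w is twice an odd
    number. Then s w^2 = 4s mod 32 as well, and the odd factor g cancels from what remains. *)
Lemma represents_4M_mod32 (u w v : int) : ~~ (2 %| u)%Z -> ~~ (2 %| v)%Z ->
  diag_form (g * p) s (g * q) (u, w, v) = 4 * M ->
  [/\ (2 %| w)%Z, ~~ (4 %| w)%Z & (32 %| p * u ^+ 2 + q * v ^+ 2)%Z].
Proof.
move=> ou ov; rewrite /diag_form/= => eM.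
have /dvdzP[k kE] := sqr_sum_mod8 _ _ ou ov.
have [h hE] : exists h, M = 8 * h + s.
  by exists ((M - s) %/ 8)%Z; clear -Ms8; lia.
have [s' sE] : exists s', s = 2 * s' + 1.
  by exists (s %/ 2)%Z; clear -s_odd; lia.
have eM' : g * (k * 8) + s * w ^+ 2 = 4 * M by rewrite -kE -eM; ring.
have w2 : (2 %| w)%Z.
  by apply/negPn/negP => /sqr_odd[l lE]; move: eM'; rewrite lE hE sE; clear; lia.
have [l lE l2] := sqr_even _ w2.
have w4 : ~~ (4 %| w)%Z.
  rewrite -l2; apply/negP => /dvdzP[l' l'E].
  by move: eM'; rewrite lE l'E hE sE; clear; lia.
split=> //.
have [w' wE] : exists w', w = 2 * w'.
  by exists (w %/ 2)%Z; clear -w2; lia.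
have [j jE] : exists j, w' ^+ 2 = 8 * j + 1 by apply: sqr_odd; clear -w4 wE; lia.
suff : (2%:Z ^+ 2 %| k)%Z by rewrite kE; clear; lia.
apply: (dvdz_odd_mull 2 _ _ g_odd).
have : w ^+ 2 = 4 * (8 * j + 1) by rewrite wE exprMn jE.
by move=> w2E; move: eM'; rewrite w2E hE; clear; lia.
Qed.

(* (pu - cv)(pu + cv) = p(pu^2 + qv^2) - 16v^2 is exactly divisible by 16, while
   the two factors differ by 2 modulo 4. *)
Lemma twist_sign (u v : int) : ~~ (2 %| u)%Z -> ~~ (2 %| v)%Z ->
  (32 %| p * u ^+ 2 + q * v ^+ 2)%Z ->
  (8 %| p * u + c * v)%Z = ~~ (8 %| p * u - c * v)%Z.
Proof.
move=> ou ov /dvdzP[k kE].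
have opu := odd_mulz _ _ p_odd ou; have ocv := odd_mulz _ _ c_odd ov.
have [S SE] : exists S, p * u + c * v = 2 * S.
  by exists ((p * u + c * v) %/ 2)%Z; clear -opu ocv; lia.
have [D DE] : exists D, p * u - c * v = 2 * D.
  by exists ((p * u - c * v) %/ 2)%Z; clear -opu ocv; lia.
have SD : S * D = 4 * (2 * p * k - v ^+ 2).
  have : (2 * S) * (2 * D) = p * (k * 32) - 16 * v ^+ 2.
    by rewrite -SE -DE -kE -norm16; ring.
  by clear; lia.
have [eS|oS] := boolP (2 %| S)%Z.
- have : (2%:Z ^+ 2 %| S)%Z.
    apply: (dvdz_odd_mull 2 D); first by clear -SE DE ocv eS; lia.
    by rewrite mulrC SD; clear; lia.
  by clear -SE DE ocv; lia.
- have : (2%:Z ^+ 2 %| D)%Z.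
    by apply: (dvdz_odd_mull 2 S) => //; rewrite SD; clear; lia.
  by clear -SE DE ocv; lia.
Qed.

(** The twist acts on the outer coordinates and the middle one is doubled. For odd x, z the image
    has odd coordinates for exactly one of the signs of z, namely when 4 divides px - cz; so half of
    each side is matched. *)
Lemma npoints_twist :
  npoints [set v | diag_form (g * p) s (g * q) v = 4 * M /\
                   ~~ (2 %| v.1.1)%Z && ~~ (2 %| v.2)%Z] =
  npoints [set v | diag_form (g * p) s (g * q) v = M /\
                   [&& ~~ (2 %| v.1.1)%Z, ~~ (2 %| v.1.2)%Z & ~~ (2 %| v.2)%Z]].
Proof.
have finQ N (P : pred (int * int * int)) :
    finite_set [set v | diag_form (g * p) s (g * q) v = N /\ P v].
  apply: sub_finite_set (finite_diag_form _ _ _ N gp_gt0 s_gt0 gq_gt0).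
  by move=> v [].
pose negz (v : int * int * int) := (v.1, - v.2).
have negzK : involutive negz by case=> v z; rewrite /negz/= opprK.
(* Exactly one of pu - cv, pu + cv is divisible by 8, and for odd px, cz exactly one of px - cz, px
   + cz is divisible by 4. *)
rewrite (npoints_double _ (fun v => 8 %| p * v.1.1 - c * v.2)%Z negz)//; last first.
  move=> [[u w] v] [/= eM /andP[ou ov]]; split; first split.
  - by rewrite -eM /diag_form/= sqrrN.
  - by rewrite ou/=; clear -ov; lia.
  have [_ _ h32] := represents_4M_mod32 _ _ _ ou ov eM.
  by rewrite mulrN opprK; apply: twist_sign.
rewrite [RHS](npoints_double _ (fun v => 4 %| p * v.1.1 - c * v.2)%Z negz)//; last first.
  move=> [[x y] z] [/= eM /and3P[ox oy oz]]; split; first split.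
  - by rewrite -eM /diag_form/= sqrrN.
  - by rewrite ox oy/=; clear -oz; lia.
  have := odd_mulz _ _ p_odd ox; have := odd_mulz _ _ c_odd oz.
  by clear; lia.
congr double; symmetry.
(* The inverse is multiplication by the conjugate (c - d)/2 divided by the norm 4, hence the
   denominators 8. *)
apply: (npoints_bij _ _
  (fun v => ((c * v.1.1 - q * v.2) %/ 2, 2 * v.1.2, (p * v.1.1 + c * v.2) %/ 2)%Z)
  (fun v => ((c * v.1.1 + q * v.2) %/ 8, v.1.2 %/ 2, (c * v.2 - p * v.1.1) %/ 8)%Z)).
- apply: sub_finite_set (finQ M (fun v => [&& ~~ (2 %| v.1.1)%Z,
    ~~ (2 %| v.1.2)%Z & ~~ (2 %| v.2)%Z])).
  by move=> v [].
- move=> [[x y] z] [[/= eM /and3P[ox oy oz]] /dvdzP[e eE]].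
  have ocz := odd_mulz _ _ c_odd oz.
  have q_odd : ~~ (2 %| q)%Z by clear -p_odd pq8; lia.
  have ocx := odd_mulz _ _ c_odd ox; have oqz := odd_mulz _ _ q_odd oz.
  set u := ((c * x - q * z) %/ 2)%Z; set v := ((p * x + c * z) %/ 2)%Z.
  have uE : 2 * u = c * x - q * z by rewrite /u; clear -ocx oqz; lia.
  have vE : 2 * v = p * x + c * z by rewrite /v; clear -eE; lia.
  have xE : c * u + q * v = 8 * x.
    have : c * (2 * u) + q * (2 * v) = 16 * x by rewrite uE vE -norm16; ring.
    by clear; lia.
  have zE : c * v - p * u = 8 * z.
    have : c * (2 * v) - p * (2 * u) = 16 * z by rewrite uE vE -norm16; ring.
    by clear; lia.
  have ov : ~~ (2 %| v)%Z by clear -vE eE ocz; lia.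
  have ou : ~~ (2 %| u)%Z.
    apply/negP => /dvdzP[u' u'E]; have := odd_mulz _ _ c_odd ov.
    by move: zE; rewrite u'E; clear; lia.
  split; last by rewrite xE zE; congr (_, _, _); clear; lia.
  split; last by rewrite /=; clear -zE; lia.
  split; last by rewrite /= ou ov.
  have := twist_norm _ _ _ _ uE vE; move: eM; rewrite /diag_form/= => <- E.
  have -> : g * p * u ^+ 2 + s * (2 * y) ^+ 2 + g * q * v ^+ 2 =
     g * (p * u ^+ 2 + q * v ^+ 2) + s * (2 * y) ^+ 2 by ring.
  by rewrite E; ring.
- move=> [[u w] v] [[/= eM /andP[ou ov]] /dvdzP[e eE]].
  have [w2 w4 /dvdzP[k kE]] := represents_4M_mod32 _ _ _ ou ov eM.
  have /dvdzP[x xE] : (2%:Z ^+ 3 %| c * u + q * v)%Z.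
    apply: (dvdz_odd_mull 3 _ _ p_odd).
    have -> : p * (c * u + q * v) = c * (p * u - c * v) + 16 * v.
      by rewrite -norm16; ring.
    by rewrite eE; clear; lia.
  rewrite (_ : 2%:Z ^+ 3 = 8)// in xE.
  pose z := - e; have zE : c * v - p * u = 8 * z by rewrite /z; clear -eE; lia.
  rewrite xE zE.
  have -> : (x * 8 %/ 8)%Z = x by clear; lia.
  have -> : (8 * z %/ 8)%Z = z by clear; lia.
  have vE : p * x + c * z = 2 * v.
    have : p * (x * 8) + c * (8 * z) = 16 * v by rewrite -xE -zE -norm16; ring.
    by clear; lia.
  have uE : c * x - q * z = 2 * u.
    have : c * (x * 8) - q * (8 * z) = 16 * u by rewrite -xE -zE -norm16; ring.
    by clear; lia.
  have E := twist_norm _ _ _ _ (esym uE) (esym vE).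
  (* For even z the factor cv - pu = 8z is divisible by 16 and cv + pu is even, so 32 would divide
     16 v^2 with v odd. *)
  have oz : ~~ (2 %| z)%Z.
    apply/negP => /dvdzP[z' z'E].
    have : (c * v - p * u) * (c * v + p * u) = 16 * v ^+ 2 - p * (k * 32).
      by rewrite -kE -norm16; ring.
    have [l ->] := sqr_odd _ ov.
    have -> : c * v + p * u = 2 * (c * v) - 8 * z by clear -zE; lia.
    by rewrite zE z'E; clear; lia.
  have ocz := odd_mulz _ _ c_odd oz.
  have ox : ~~ (2 %| x)%Z.
    by apply/negP => /dvdzP[x' x'E]; move: vE; rewrite x'E; clear -ocz; lia.
  have [w' wE] : exists w', w = 2 * w'.
  by exists (w %/ 2)%Z; clear -w2; lia.
  have -> : (w %/ 2)%Z = w' by clear -wE; lia.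
  have ow' : ~~ (2 %| w')%Z by clear -w4 wE; lia.
  split; last by rewrite uE vE wE; congr (_, _, _); clear; lia.
  split; first split.
  + have : 4 * diag_form (g * p) s (g * q) (x, w', z) = 4 * M;
      last by move: (diag_form _ _ _ _); clear; lia.
    rewrite -eM /diag_form/= wE.
    have -> : g * p * u ^+ 2 + s * (2 * w') ^+ 2 + g * q * v ^+ 2 =
      g * (p * u ^+ 2 + q * v ^+ 2) + s * (2 * w') ^+ 2 by ring.
    by rewrite E; ring.
  + by rewrite /= ox ow' oz.
  + by rewrite /=; clear -vE ov ocz; lia.
Qed.

End BinaryTwist.

(** * Triangular numbers and solutions in odd integers *)

Lemma tri_double (x : int) : 2 * tri x = x * (x - 1).
Proof.
rewrite /tri; pose y := (x %/ 2)%Z.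
have [->|->] : x = 2 * y \/ x = 2 * y + 1 by rewrite /y; lia.
- have -> : 2 * y * (2 * y - 1) = 2 * (y * (2 * y - 1)) by ring.
  by clear; lia.
- have -> : (2 * y + 1) * (2 * y + 1 - 1) = 2 * ((2 * y + 1) * y) by ring.
  by clear; lia.
Qed.

Lemma odd_sqr_tri (x : int) : (2 * x - 1) ^+ 2 = 8 * tri x + 1.
Proof.
have -> : 8 * tri x = 4 * (2 * tri x) by ring.
by rewrite tri_double; ring.
Qed.

Lemma t_odd_points (a b c n : int) : 0 < a -> 0 < b -> 0 < c ->
  t a b c n = npoints [set v | diag_form a b c v = 8 * n + a + b + c /\
    [&& ~~ (2 %| v.1.1)%Z, ~~ (2 %| v.1.2)%Z & ~~ (2 %| v.2)%Z]].
Proof.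
move=> a0 b0 c0; symmetry; apply: (npoints_bij _ _
  (fun v => ((v.1.1 + 1) %/ 2, (v.1.2 + 1) %/ 2, (v.2 + 1) %/ 2)%Z)
  (fun v => (2 * v.1.1 - 1, 2 * v.1.2 - 1, 2 * v.2 - 1))).
- apply: sub_finite_set (finite_diag_form _ _ _ (8 * n + a + b + c) a0 b0 c0).
  by move=> v [].
- move=> [[x y] z] [/= + /and3P[ox oy oz]].
  pose x' := ((x + 1) %/ 2)%Z; pose y' := ((y + 1) %/ 2)%Z.
  pose z' := ((z + 1) %/ 2)%Z.
  have xE : x = 2 * x' - 1 by rewrite /x'; clear -ox; lia.
  have yE : y = 2 * y' - 1 by rewrite /y'; clear -oy; lia.
  have zE : z = 2 * z' - 1 by rewrite /z'; clear -oz; lia.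
  rewrite -/x' -/y' -/z' -xE -yE -zE => E; split=> //; move: E.
  rewrite /diag_form/= xE yE zE !odd_sqr_tri; clear; lia.
- move=> [[x y] z] /= E; split; first split.
  + by rewrite /diag_form/= !odd_sqr_tri -E; ring.
  + by rewrite /=; clear; lia.
  + by rewrite /=; congr (_, _, _); clear; lia.
Qed.

(** * Parity classes of the solutions of F = m and F = 4m *)

Section EisensteinForm.

Variables a b n : int.
Hypotheses (a_gt0 : 0 < a) (b_gt0 : 0 < b).
Hypotheses (a_odd : ~~ (2 %| a)%Z) (b_odd : ~~ (2 %| b)%Z).

Let m := 8 * n + 4 * a + b.
Let F := diag_form a (3 * a) b.

Lemma finite_represent N (P : pred (int * int * int)) :
  finite_set [set v | F v = N /\ P v].
Proof.
have a3_gt0 : 0 < 3 * a by lia.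
apply: sub_finite_set (finite_diag_form _ _ _ N a_gt0 a3_gt0 b_gt0).
by move=> v [].
Qed.

(** For odd x, y exactly one of x - y, x + y is divisible by 4, so the sign of y can be normalised.
    [P] covers both parities of z. *)
Lemma odd_points_mod4 N (P : pred int) : (forall z, P (- z) = P z) ->
  npoints [set v | F v = N /\ [&& ~~ (2 %| v.1.1)%Z, ~~ (2 %| v.1.2)%Z & P v.2]] =
  (npoints [set v |
    (F v = N /\ [&& ~~ (2 %| v.1.1)%Z, ~~ (2 %| v.1.2)%Z & P v.2]) /\
    (4 %| v.1.1 - v.1.2)%Z]).*2.
Proof.
move=> PN; apply: (npoints_double _ (fun v => 4 %| v.1.1 - v.1.2)%Z
  (fun v => (v.1.1, - v.1.2, v.2))).
- exact: (finite_represent N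
    (fun v => [&& ~~ (2 %| v.1.1)%Z, ~~ (2 %| v.1.2)%Z & P v.2])).
- by case=> [[x y] z]; rewrite /= opprK.
- move=> [[x y] z] [/= E /and3P[ox oy Pz]]; split; first split.
  + by rewrite -E /F /diag_form/= sqrrN.
  + by rewrite /= ox Pz /= andbT; clear -oy; lia.
  + by rewrite /=; clear -ox oy; lia.
Qed.

(* Multiplication by a cube root of unity in the Eisenstein integers. *)
Lemma npoints_odd_even :
  npoints [set v | F v = m /\
    [&& ~~ (2 %| v.1.1)%Z, ~~ (2 %| v.1.2)%Z & ~~ (2 %| v.2)%Z]] =
  (npoints [set v | F v = m /\
    [&& (2 %| v.1.1)%Z, (2 %| v.1.2)%Z & ~~ (2 %| v.2)%Z]]).*2.
Proof.
rewrite (odd_points_mod4 m (fun z => ~~ (2 %| z)%Z)); last by clear; lia.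
(* On x + y sqrt(-3) this is multiplication by (1 - sqrt(-3))/2 followed by conjugation, which makes
   it an involution preserving x^2 + 3y^2. *)
congr double; pose f (v : int * int * int) :=
  (((v.1.1 + 3 * v.1.2) %/ 2)%Z, ((v.1.1 - v.1.2) %/ 2)%Z, v.2).
apply: (npoints_bij _ _ f f); rewrite /f.
- apply: sub_finite_set (finite_represent m (fun=> true)) => v [[]] //.
- move=> [[x y] z] [[/= E /and3P[ox oy oz]] /dvdzP[k kE]].
  have xE : x = y + 4 * k by clear -kE; lia.
  have -> : ((x + 3 * y) %/ 2)%Z = 2 * (y + k) by clear -xE; lia.
  have -> : ((x - y) %/ 2)%Z = 2 * k by clear -xE; lia.
  split; last by congr (_, _, _); clear -xE; lia.
  split; last by rewrite oz; clear; lia.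
  by rewrite -E xE /F /diag_form/=; ring.
- move=> [[x y] z] [/= E /and3P[ex ey oz]].
  have [j jE j2] := sqr_even _ ex; have [k kE k2] := sqr_even _ ey.
  have [l lE] := sqr_odd _ oz.
  (* Modulo 8 the equation reads 4a(j + 3k) = 4a, so exactly one of x/2, y/2 is odd, and the image
     has odd first coordinates. *)
  have jk : ~~ (2 %| j + k)%Z.
    apply/negP => /dvdzP[i iE]; have jE' : j = i * 2 - k by clear -iE; lia.
    have [a' aE] : exists a', a = 2 * a' + 1.
      by exists (a %/ 2)%Z; clear -a_odd; lia.
    move: E; rewrite /F /diag_form/= /m jE kE lE jE' aE.
    by clear; lia.
  have [x' xE] : exists x', x = 2 * x' by exists (x %/ 2)%Z; clear -ex; lia.
  have [y' yE] : exists y', y = 2 * y' by exists (y %/ 2)%Z; clear -ey; lia.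
  have xy : ~~ (2 %| x' + y')%Z by clear -jk j2 k2 xE yE; lia.
  have -> : ((x + 3 * y) %/ 2)%Z = x' + 3 * y' by clear -xE yE; lia.
  have -> : ((x - y) %/ 2)%Z = x' - y' by clear -xE yE; lia.
  split; last by congr (_, _, _); clear -xE yE; lia.
  split; first split.
  + by rewrite -E xE yE /F /diag_form/=; ring.
  + by rewrite oz; clear -xy; lia.
  + by clear; lia.
Qed.

(** The map (x,y) |-> (x + 3y, x - y) multiplies x^2 + 3y^2 by 4. As m is odd, z even forces x + y
    odd, so the image is a pair of odd integers whose difference is 4y. *)
Lemma npoints_odd_odd_even :
  npoints [set v | F v = 4 * m /\
    [&& ~~ (2 %| v.1.1)%Z, ~~ (2 %| v.1.2)%Z & (2 %| v.2)%Z]] =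
  (npoints [set v | F v = m /\ (2 %| v.2)%Z]).*2.
Proof.
rewrite (odd_points_mod4 (4 * m) (fun z => (2 %| z)%Z)); last by clear; lia.
congr double; symmetry.
have [a' aE] : exists a', a = 2 * a' + 1 by exists (a %/ 2)%Z; clear -a_odd; lia.
have [b' bE] : exists b', b = 2 * b' + 1 by exists (b %/ 2)%Z; clear -b_odd; lia.
apply: (npoints_bij _ _
  (fun v => (v.1.1 + 3 * v.1.2, v.1.1 - v.1.2, 2 * v.2))
  (fun v => ((v.1.1 + 3 * v.1.2) %/ 4, (v.1.1 - v.1.2) %/ 4, v.2 %/ 2)%Z)).
- exact: (finite_represent m (fun v => (2 %| v.2)%Z)).
- move=> [[x y] z] [/= E ez].
  have xy : ~~ (2 %| x + y)%Z.
    apply/negP => /dvdzP[i iE]; have xE : x = i * 2 - y by clear -iE; lia.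
    have [k kE _] := sqr_even _ ez.
    by move: E; rewrite /F /diag_form/= /m xE kE bE; clear; lia.
  split; last by congr (_, _, _); clear; lia.
  split; last by rewrite /=; clear; lia.
  split; last by rewrite /=; clear -xy; lia.
  by rewrite -E /F /diag_form/=; ring.
- move=> [[x y] z] [[/= E /and3P[ox oy ez]] /dvdzP[k kE]].
  have xE : x = y + 4 * k by clear -kE; lia.
  have [z' zE] : exists z', z = 2 * z' by exists (z %/ 2)%Z; clear -ez; lia.
  have -> : ((x + 3 * y) %/ 4)%Z = y + k by clear -xE; lia.
  have -> : ((x - y) %/ 4)%Z = k by clear -xE; lia.
  have -> : (z %/ 2)%Z = z' by clear -zE; lia.
  split; last by congr (_, _, _); clear -xE zE; lia.
  split.
    have : 4 * F (y + k, k, z') = 4 * m.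
      by rewrite -E xE zE /F /diag_form/=; ring.
    by move: (F _); clear; lia.
  (* For odd z' the left side would be 4a + 4b = 0 modulo 8, whereas 4m = 4 modulo 8. *)
  apply/negPn/negP => /sqr_odd[l lE].
  have [i iE] := sqr_odd _ ox; have [j jE] := sqr_odd _ oy.
  have E4 : a * x ^+ 2 + 3 * a * y ^+ 2 + b * (4 * z' ^+ 2) = 4 * m.
    by rewrite -E /F /diag_form/= zE; ring.
  by move: E4; rewrite iE jE lE /m aE bE; clear; lia.
Qed.

Lemma npoints_even :
  npoints [set v | F v = 4 * m /\
    [&& (2 %| v.1.1)%Z, (2 %| v.1.2)%Z & (2 %| v.2)%Z]] = r F m.
Proof.
symmetry; apply: (npoints_bij _ _
  (fun v => (2 * v.1.1, 2 * v.1.2, 2 * v.2))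
  (fun v => (v.1.1 %/ 2, v.1.2 %/ 2, v.2 %/ 2)%Z)).
- by apply: sub_finite_set (finite_represent m (fun=> true)).
- move=> [[x y] z] /= E; split; last by congr (_, _, _); clear; lia.
  by split; [rewrite -E /F /diag_form/=; ring|rewrite /=; clear; lia].
- move=> [[x y] z] [/= E /and3P[/dvdzP[x' xE] /dvdzP[y' yE] /dvdzP[z' zE]]].
  rewrite xE yE zE.
  have K (u : int) : (u * 2 %/ 2)%Z = u by clear; lia.
  rewrite !K; split; last by congr (_, _, _); ring.
  have : 4 * F (x', y', z') = 4 * m.
    by rewrite -E xE yE zE /F /diag_form/=; ring.
  by move: (F _); clear; lia.
Qed.

Lemma same_parity x y : (4 %| a * x ^+ 2 + 3 * a * y ^+ 2)%Z ->
  (2 %| x)%Z = (2 %| y)%Z.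
Proof.
have [a' aE] : exists a', a = 2 * a' + 1 by exists (a %/ 2)%Z; clear -a_odd; lia.
have [ex|ox] := boolP (2 %| x)%Z; have [ey|oy] := boolP (2 %| y)%Z => //.
- have [i -> _] := sqr_even _ ex; have [j ->] := sqr_odd _ oy.
  by rewrite aE; clear; lia.
- have [i ->] := sqr_odd _ ox; have [j -> _] := sqr_even _ ey.
  by rewrite aE; clear; lia.
Qed.

(** For odd z, a(x^2 + 3y^2) = m - b z^2 is divisible by 4, which excludes x, y of different
    parity. *)
Lemma r_split :
  r F m = (npoints [set v | F v = m /\ (2 %| v.2)%Z] +
    npoints [set v | F v = m /\
      [&& ~~ (2 %| v.1.1)%Z, ~~ (2 %| v.1.2)%Z & ~~ (2 %| v.2)%Z]] +
    npoints [set v | F v = m /\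
      [&& (2 %| v.1.1)%Z, (2 %| v.1.2)%Z & ~~ (2 %| v.2)%Z]])%N.
Proof.
rewrite /r (npoints_split _ (fun v => (2 %| v.2)%Z)); last first.
  by apply: sub_finite_set (finite_represent m (fun=> true)).
rewrite -addnA; congr addn.
rewrite (npoints_split _ (fun v => ~~ (2 %| v.1.1)%Z)); last first.
  exact: (finite_represent m (fun v => ~~ (2 %| v.2)%Z)).
have parity x y z : F (x, y, z) = m -> ~~ (2 %| z)%Z -> (2 %| x)%Z = (2 %| y)%Z.
  move=> E /sqr_odd[l lE]; apply: same_parity.
  have -> : a * x ^+ 2 + 3 * a * y ^+ 2 = m - b * z ^+ 2.
    by rewrite -E /F /diag_form/=; ring.
  by rewrite lE /m; clear; lia.
congr (_ + _)%N; congr npoints; apply/seteqP; split=> -[[x y] z] /=.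
- by move=> [[E oz] ox]; rewrite -(parity _ _ _ E oz) ox oz.
- by move=> [E /and3P[]].
- move=> [[E oz]]; rewrite negbK => ex.
  by rewrite -(parity _ _ _ E oz) ex oz.
- by move=> [E /and3P[-> _ ->]].
Qed.

(** For even z, 4 divides 4m - b z^2, so again x and y have the same parity; the case z odd is kept
    whole for the twist. *)
Lemma r4_split :
  r F (4 * m) = (npoints [set v | F v = (4 * m)%R /\ ~~ (2 %| v.2)%Z] +
    npoints [set v | F v = (4 * m)%R /\
      [&& ~~ (2 %| v.1.1)%Z, ~~ (2 %| v.1.2)%Z & (2 %| v.2)%Z]] +
    npoints [set v | F v = (4 * m)%R /\
      [&& (2 %| v.1.1)%Z, (2 %| v.1.2)%Z & (2 %| v.2)%Z]])%N.
Proof.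
rewrite /r (npoints_split _ (fun v => (2 %| v.2)%Z)); last first.
  by apply: sub_finite_set (finite_represent (4 * m) (fun=> true)).
rewrite addnC -addnA; congr addn.
rewrite (npoints_split _ (fun v => ~~ (2 %| v.1.1)%Z)); last first.
  exact: (finite_represent (4 * m) (fun v => (2 %| v.2)%Z)).
have parity x y z : F (x, y, z) = 4 * m -> (2 %| z)%Z -> (2 %| x)%Z = (2 %| y)%Z.
  move=> E /sqr_even[l lE _]; apply: same_parity.
  have -> : a * x ^+ 2 + 3 * a * y ^+ 2 = 4 * m - b * z ^+ 2.
    by rewrite -E /F /diag_form/=; ring.
  by rewrite lE /m; clear; lia.
congr (_ + _)%N; congr npoints; apply/seteqP; split=> -[[x y] z] /=.
- by move=> [[E ez] ox]; rewrite -(parity _ _ _ E ez) ox ez.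
- by move=> [E /and3P[]].
- move=> [[E ez]]; rewrite negbK => ex.
  by rewrite -(parity _ _ _ E ez) ex ez.
- by move=> [E /and3P[-> _ ->]].
Qed.

(** With T = t and E the number of solutions of F = m with z even, r(F,m) = E + 3T/2 and r(F,4m) = T
    + 2E + r(F,m), so 3r(F,m) - r(F,4m) = 2r(F,m) - T - 2E = 2T. *)
Lemma t_eq_r_of_twist :
  npoints [set v | F v = 4 * m /\ ~~ (2 %| v.2)%Z] =
  npoints [set v | F v = m /\
    [&& ~~ (2 %| v.1.1)%Z, ~~ (2 %| v.1.2)%Z & ~~ (2 %| v.2)%Z]] ->
  2 * (t a (3 * a) b n)%:Z = 3 * (r F m)%:Z - (r F (4 * m))%:Z.
Proof.
move=> twist; have a3_gt0 : 0 < 3 * a by lia.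
have := t_odd_points _ _ _ n a_gt0 a3_gt0 b_gt0.
rewrite (_ : 8 * n + a + 3 * a + b = m); last by rewrite /m; ring.
rewrite -/F => tE; rewrite tE.
have := npoints_odd_even; have := npoints_odd_odd_even; have := npoints_even.
have := r_split; have := r4_split; rewrite twist.
move: (npoints _) (npoints _) (npoints _) (npoints _) (npoints _) (r _ _) (r _ _).
by clear; lia.
Qed.

End EisensteinForm.

(** * From the ratio condition to the twist *)

(** The twist pairs the first and third coordinates; exchanging the first two makes it available for
    the pair 3a, b. *)
Lemma npoints_swap (a b c N : int) : 0 < a -> 0 < b -> 0 < c ->
  forall P : rel int, forall Q : pred int,
  npoints [set v | diag_form a b c v = N /\ P v.1.1 v.1.2 && Q v.2] =
  npoints [set v | diag_form b a c v = N /\ P v.1.2 v.1.1 && Q v.2].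
Proof.
move=> a0 b0 c0 P Q; pose f (v : int * int * int) := (v.1.2, v.1.1, v.2).
apply: (npoints_bij _ _ f f); rewrite /f.
- apply: sub_finite_set (finite_diag_form _ _ _ N a0 b0 c0).
  by move=> v [].
- by move=> [[x y] z] [/= <- h]; do !split => //; rewrite /diag_form/=; ring.
- by move=> [[x y] z] [/= <- h]; do !split => //; rewrite /diag_form/=; ring.
Qed.

(** Modulo 4 with z odd: x, y both even would give 4 | b, x alone odd gives 4 | a + b, and y alone
    odd gives 4 | 3a + b. The last two exclude each other since their difference 2a is not divisible
    by 4. *)
Lemma odd_coordinate (a b N x y z : int) :
  ~~ (2 %| a)%Z -> ~~ (2 %| b)%Z -> ~~ (2 %| z)%Z ->
  diag_form a (3 * a) b (x, y, z) = 4 * N ->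
  ((4 %| a + b)%Z -> ~~ (2 %| x)%Z) /\ ((4 %| 3 * a + b)%Z -> ~~ (2 %| y)%Z).
Proof.
rewrite /diag_form/= => oa ob /sqr_odd[l ->].
have even_a (e : int) : a = 2 * e -> False by clear -oa; lia.
have even_b (e : int) : b = 2 * e -> False by clear -ob; lia.
have [ex|ox] := boolP (2 %| x)%Z; have [ey|oy] := boolP (2 %| y)%Z => /=.
- have [i -> _] := sqr_even _ ex; have [j -> _] := sqr_even _ ey => E.
  exfalso; apply: (even_b (2 * (N - a * i - 3 * a * j - 2 * b * l))).
  by clear -E; lia.
- have [i -> _] := sqr_even _ ex; have [j ->] := sqr_odd _ oy => E.
  split=> // /dvdzP[k kE]; exfalso.
  apply: (even_a (N - k - a * i - 6 * a * j - 2 * b * l)).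
  by clear -E kE; lia.
- have [i ->] := sqr_odd _ ox; have [j -> _] := sqr_even _ ey => E.
  split=> // /dvdzP[k kE]; exfalso.
  apply: (even_a (k - N + 2 * a * i + 3 * a * j + 2 * b * l)).
  by clear -E kE; lia.
- by [].
Qed.

Lemma intr_ratio (x y : int) (k l : nat) : y != 0 -> (0 < l)%N ->
  x%:Q / y%:Q = k%:R / l%:R -> l%:Z * x = k%:Z * y.
Proof.
move=> y0 l0 E.
have yQ : y%:Q != 0 by rewrite intr_eq0.
have lQ : l%:R != 0 :> rat by rewrite pnatr_eq0 -lt0n.
move/eqP: E; rewrite eqr_div// => /eqP E.
apply/eqP; rewrite -(eqr_int rat) !intrM -!pmulrn mulrC; apply/eqP.
by rewrite E.
Qed.

(* c^2 + p q = 16 makes (c + sqrt(- p q)) / 2 an element of norm 4 in the ring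
   of integers of Q(sqrt(-7)) or Q(sqrt(-15)), where 2 splits. *)
Lemma ratio_norm16 (u v : int) : ~~ (2 %| v)%Z -> 0 < u -> 0 < v ->
  (exists2 q : rat, q = u%:Q / v%:Q \/ q = v%:Q / u%:Q & q \in [:: 5 / 3; 7; 15]) ->
  exists g p q c : int,
    [/\ u = g * p, v = g * q, c ^+ 2 + p * q = 16, (8 %| p + q)%Z &
        [&& ~~ (2 %| g)%Z, ~~ (2 %| p)%Z & ~~ (2 %| c)%Z]].
Proof.
move=> ov u0 v0 [q].
have key (x y : int) : 0 < x -> 0 < y ->
    x%:Q / y%:Q \in [:: 5 / 3; 7; 15] ->
    [\/ 3 * x = 5 * y, x = 7 * y | x = 15 * y].
  move=> x0 y0; have yn0 : y != 0 by lia.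
  rewrite !inE => /or3P[] /eqP E.
  - by apply: Or31; apply: (intr_ratio _ _ 5 3).
  - apply: Or32; rewrite -[x]mul1r.
    by apply: (intr_ratio _ _ 7 1) => //; rewrite E divr1.
  - apply: Or33; rewrite -[x]mul1r.
    by apply: (intr_ratio _ _ 15 1) => //; rewrite E divr1.
(* In all six cases g is the gcd of u and v, and p, q is the reduced ratio; c = 1 when pq = 15 and c
   = 3 when pq = 7. *)
case=> -> /key; case=> // E.
- by exists (v %/ 3)%Z, 5, 3, 1; split=> //; clear -E ov; lia.
- by exists v, 7, 1, 3; split=> //; clear -E ov; lia.
- by exists v, 15, 1, 1; split=> //; clear -E ov; lia.
- by exists (u %/ 3)%Z, 3, 5, 1; split=> //; clear -E ov; lia.
- by exists u, 1, 7, 3; split=> //; clear -E ov; lia.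
- by exists u, 1, 15, 1; split=> //; clear -E ov; lia.
Qed.

Theorem theorem3p5 (a b : int)
  (a_gt0 : 0 < a) (b_gt0 : 0 < b)
  (a_odd : ~~ (2 %| a)%Z) (b_odd : ~~ (2 %| b)%Z)
  (co_ab : coprimez a b)
  (ratio_ab : exists2 q : rat,
     q \in [:: b%:Q / a%:Q; a%:Q / b%:Q; 3 * a%:Q / b%:Q; b%:Q / (3 * a%:Q)]
     & q \in [:: 5 / 3; 7; 15]) :
  forall n : int, 0 < n ->
    2 * (t a (3 * a) b n)%:Z =
      3 * (r (diag_form a (3 * a) b) (8 * n + 4 * a + b))%:Z
      - (r (diag_form a (3 * a) b) (4 * (8 * n + 4 * a + b)))%:Z.
Proof.
move=> n _; have a3_gt0 : 0 < 3 * a by lia.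
have a3_odd : ~~ (2 %| 3 * a)%Z by lia.
have a3Q : 3 * a%:Q = (3 * a)%:Q by rewrite intrM.
apply: t_eq_r_of_twist => //.
(* The four fractions concern either the pair a, b or the pair 3a, b, each up to inversion. *)
have [[q qE qin]|[q qE qin]] :
    (exists2 q : rat, q = a%:Q / b%:Q \/ q = b%:Q / a%:Q & q \in [:: 5 / 3; 7; 15])
    \/ (exists2 q : rat, q = (3 * a)%:Q / b%:Q \/ q = b%:Q / (3 * a)%:Q &
          q \in [:: 5 / 3; 7; 15]).
- case: ratio_ab => q + qin; rewrite a3Q !inE => /or4P[] /eqP qE.
  + by left; exists q => //; right.
  + by left; exists q => //; left.
  + by right; exists q => //; left.
  + by right; exists q => //; right.
- have [|g [p [q' [c [aE bE norm16 pq8 /and3P[og op oc]]]]]] :=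
    ratio_norm16 a b b_odd a_gt0 b_gt0; first by exists q.
  have ab8 : (8 %| a + b)%Z by rewrite aE bE -mulrDr dvdz_mull.
  (* Here x and z are twisted and s = 3a; m - 3a = 8n + a + b is divisible by 8. *)
  have := npoints_twist g p q' c (3 * a) (8 * n + 4 * a + b) og op oc a3_odd.
  rewrite -aE -bE => /(_ a_gt0 a3_gt0 b_gt0 norm16 pq8) <-; last first.
    by clear -ab8; lia.
  (* The twist asks for x and z odd, but 4 | a + b makes x odd as soon as z is. *)
  congr npoints; apply/seteqP; split=> -[[x y] z] /= [E]; last by move=> /andP[].
  move=> oz; rewrite oz andbT; split=> //.
  apply: (proj1 (odd_coordinate _ _ _ _ _ _ a_odd b_odd oz E)).
  by clear -ab8; lia.
- have [|g [p [q' [c [aE bE norm16 pq8 /and3P[og op oc]]]]]] :=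
    ratio_norm16 (3 * a) b b_odd a3_gt0 b_gt0; first by exists q.
  have ab8 : (8 %| 3 * a + b)%Z by rewrite aE bE -mulrDr dvdz_mull.
  have := npoints_twist g p q' c a (8 * n + 4 * a + b) og op oc a_odd.
  rewrite -aE -bE => /(_ a3_gt0 a_gt0 b_gt0 norm16 pq8).
  have -> : (8 %| 8 * n + 4 * a + b - a)%Z by clear -ab8; lia.
  move=> /(_ isT) tw.
  (* Now y and z are twisted with s = a: the first two coordinates are exchanged before the twist
     and restored after it. *)
  transitivity (npoints [set v | diag_form (3 * a) a b v =
      4 * (8 * n + 4 * a + b) /\ ~~ (2 %| v.1.1)%Z && ~~ (2 %| v.2)%Z]).
    rewrite (npoints_swap _ _ _ _ a3_gt0 a_gt0 b_gt0
      (fun x _ => ~~ (2 %| x)%Z) (fun z => ~~ (2 %| z)%Z)).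
    congr npoints; apply/seteqP; split=> -[[x y] z] /= [E]; last by move=> /andP[].
    move=> oz; rewrite oz andbT; split=> //.
    apply: (proj2 (odd_coordinate _ _ _ _ _ _ a_odd b_odd oz E)).
    by clear -ab8; lia.
  rewrite tw.
  under eq_set => v do rewrite andbA.
  rewrite (npoints_swap _ _ _ _ a3_gt0 a_gt0 b_gt0
    (fun x y => ~~ (2 %| x)%Z && ~~ (2 %| y)%Z) (fun z => ~~ (2 %| z)%Z)).
  congr npoints; apply/seteqP; split=> -[[x y] z] /= [E].
    by move=> /andP[/andP[-> ->] ->].
  by move=> /and3P[-> -> ->].
Qed.
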